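(* Let $n\ge 1$, let $G$ be a subgroup of the group $\mathbb{S}_n\subset \mathrm{GL}(n,\mathbb{Z})$ of permutation matrices of size $n$, let $K/F$ be a finite Galois extension with Galois group $G$ (that is, equipped with a fixed isomorphism $\iota: G\to \mathrm{Gal}(K/F)$), and let $\alpha\in K$ be a normal element for $K/F$. Let $G$ act on the rational function field $K(x_1,\ldots,x_n)$ by acting on $K$ through $\iota$ and by permuting the indeterminates $x_1,\ldots,x_n$ according to the permutation matrices in $G$ (as specified in the context). Then $$K(x_1,\ldots,x_n)^G = F(y_1,\ldots,y_n),$$ where $$y_i = \sum_{g\in G} g(\alpha x_i),\qquad i=1,\ldots,n.$$
   Context: Normal element: for a finite Galois extension $K/F$, an element $\alpha\in K$ is normal if $\alpha$ and all its Galois conjugates form an $F$-basis of $K$, i.e. $\{\sigma(\alpha):\sigma\in \mathrm{Gal}(K/F)\}$, indexed by $\mathrm{Gal}(K/F)$, is an $F$-basis of $K$. Action of $G$: let $\mathbf{e}_1,\ldots,\mathbf{e}_n$ be the standard basis (column vectors) of $\mathbb{Z}^n$, on which $G\le \mathrm{GL}(n,\mathbb{Z})$ acts by left multiplication. Given the isomorphism $\iota: G\to\mathrm{Gal}(K/F)$, the group $G$ acts by field automorphisms on $K(x_1,\ldots,x_n)$, where $x_1,\ldots,x_n$ are indeterminates over $K$, as follows: for $g\in G$ and $\beta\in K$, $g(\beta)=(\iota(g))(\beta)$; and for $g\in G$ and $1\le i\le n$, $g(x_i)=\prod_{j=1}^n x_j^{g_{j,i}}$, where $g_{j,i}$ is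 the $(j,i)$ entry of $g$. For a permutation matrix $g$ this means $g(x_i)=x_j$ where $j$ is the index with $g(\mathbf{e}_i)=\mathbf{e}_j$. $K(x_1,\ldots,x_n)^G$ denotes the subfield of elements fixed by all of $G$, and $F(y_1,\ldots,y_n)$ denotes the subfield of $K(x_1,\ldots,x_n)$ generated over $F$ by $y_1,\ldots,y_n$. *)

(* Defs.v *)
From HB Require Import structures.
From mathcomp Require Import all_boot all_order all_algebra all_fingroup all_field.
From mathcomp Require Import generic_quotient fraction.
From mathcomp Require Import mpoly.

Set Implicit Arguments.
Unset Strict Implicit.
Unset Printing Implicit Defensive.

Import GRing.Theory.
Local Open Scope ring_scope.
Local Open Scope quotient_scope.

(* The group of n x n permutation matrices, a finite subgroup of GL(n, Z);    *)
(* the group law is the matrix product.                                       *)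
Record permMx (n : nat) :=
  PermMx { permMx_val :> 'M[int]_n; _ : is_perm_mx permMx_val }.

Section PermMxGroup.
Variable n : nat.

HB.instance Definition _ := [isSub for @permMx_val n].
HB.instance Definition _ := [Countable of permMx n by <:].

Definition permMx_of (s : 'S_n) : permMx n := PermMx (perm_mx_is_perm int s).

Fact permMxP (g : permMx n) : exists s, permMx_val g == perm_mx s.
Proof. by case: g => A /= /is_perm_mxP[s ->]; exists s. Qed.

Definition perm_of_permMx (g : permMx n) : 'S_n := xchoose (permMxP g).

Lemma perm_of_permMxK : cancel perm_of_permMx permMx_of.
Proof.
by move=> g; apply: val_inj; rewrite /= -(eqP (xchooseP (permMxP g))).
Qed.

Lemma permMxE (g : permMx n) j i : g j i = (perm_of_permMx g j == i)%:R :> int.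
Proof. by rewrite -{1}(perm_of_permMxK g) /= !mxE. Qed.

HB.instance Definition _ :=
  isFinite.Build (permMx n) (pcan_enumP (can_pcan perm_of_permMxK)).

Fact permMx_mul_subproof (g h : permMx n) :
  is_perm_mx (permMx_val g *m permMx_val h).
Proof. by rewrite is_perm_mxMl ?(valP g) ?(valP h). Qed.

Fact permMx_inv_subproof (g : permMx n) : is_perm_mx (permMx_val g)^T.
Proof. by rewrite is_perm_mx_tr (valP g). Qed.

Definition permMx_mul (g h : permMx n) := PermMx (permMx_mul_subproof g h).
Definition permMx_one : permMx n := PermMx (is_perm_mx1 int n).
Definition permMx_inv (g : permMx n) := PermMx (permMx_inv_subproof g).

Fact permMx_mulA : associative permMx_mul.
Proof. by move=> g h k; apply: val_inj; rewrite /= mulmxA. Qed.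
Fact permMx_mul1 : left_id permMx_one permMx_mul.
Proof. by move=> g; apply: val_inj; rewrite /= mul1mx. Qed.
Fact permMx_mulV : left_inverse permMx_one permMx_inv permMx_mul.
Proof.
move=> g; apply: val_inj; rewrite /=; case/is_perm_mxP: (valP g) => s /= ->.
by rewrite tr_perm_mx -perm_mxM mulVg perm_mx1.
Qed.

HB.instance Definition _ :=
  Finite_isGroup.Build (permMx n) permMx_mulA permMx_mul1 permMx_mulV.

Lemma permMxM (g h : permMx n) : (g * h)%g = g *m h :> 'M[int]_n.
Proof. by []. Qed.

Lemma perm_of_permMxM (g h : permMx n) :
  perm_of_permMx (g * h)%g = (perm_of_permMx g * perm_of_permMx h)%g.
Proof.
apply/permP=> i; apply/eqP; have := permMxE (g * h)%g i.
move=> /(_ ((perm_of_permMx g * perm_of_permMx h)%g i)).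
rewrite permMxM -{1}(perm_of_permMxK g) -{1}(perm_of_permMxK h) /=.
by rewrite -perm_mxM !mxE eqxx; case: eqP.
Qed.

End PermMxGroup.

Lemma fracE (R : idomainType) (f : {fraction R}) :
  f = FracField.tofrac \n_(repr f) / FracField.tofrac \d_(repr f).
Proof.
have d0 := denom_ratioP (repr f).
apply: (canRL (mulfK _)); first by rewrite tofrac_eq0.
rewrite -{1}[f]reprK; unlock FracField.tofrac.
rewrite -[LHS]FracField.pi_mul; apply/eqmodP; rewrite /= FracField.equivfE.
by rewrite /FracField.mulf !numden_Ratio ?mulf_neq0 ?oner_neq0 // !mulr1 mulrC.
Qed.

Section Definitions.
Variables (F : fieldType) (K : splittingFieldType F) (n : nat).

Definition normal_element (a : K) : bool :=
  basis_of {:K} [seq (s : gal_of {:K}) a | s in 'Gal({:K} / 1)%g].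

(* iota restricts to an isomorphism from G onto Gal(K/F), the latter being a  *)
(* group under composition of functions. The product of 'Gal(_ / _) is the    *)
(* opposite one ((s * t) a = t (s a), see galM), so isom is not applicable.   *)
Definition galois_iso (G : {group permMx n}) (iota : permMx n -> gal_of {:K}) :=
  [/\ {in G &, forall g h (a : K), iota (g * h)%g a = iota g (iota h a)},
      {in G &, injective iota} &
      iota @: G = 'Gal({:K} / 1)%g].

Definition ratfun := {fraction {mpoly K[n]}}.
HB.instance Definition _ := GRing.Field.on ratfun.

Definition rconst (b : K) : ratfun := FracField.tofrac b%:MP.
HB.instance Definition _ :=
  GRing.RMorphism.copy rconst (@FracField.tofrac {mpoly K[n]} \o @mpolyC n K).
Definition rvar (i : 'I_n) : ratfun := FracField.tofrac 'X_i.

Section Action.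
Variable iota : permMx n -> gal_of {:K}.

Definition poly_act (g : permMx n) (p : {mpoly K[n]}) : ratfun :=
  mmap (rconst \o iota g) (fun i => \prod_(j < n) rvar j ^ g j i) p.

(* poly_act g is an injective ring morphism, so that the value below does not *)
(* depend on the chosen representative of f (rat_act_frac); rat_act g is the  *)
(* ring morphism extending iota g with x_i |-> \prod_j x_j ^ g j i.           *)
Definition rat_act (g : permMx n) (f : ratfun) : ratfun :=
  poly_act g \n_(repr f) / poly_act g \d_(repr f).

Definition fixed_by (G : {group permMx n}) (f : ratfun) : Prop :=
  forall g, g \in G -> rat_act g f = f.

Implicit Types (g h : permMx n) (p q : {mpoly K[n]}) (f : ratfun).

HB.instance Definition _ g :=
  GRing.RMorphism.copy (poly_act g) (mmap (rconst \o iota g) _).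

Lemma poly_act_const g b : poly_act g b%:MP = rconst (iota g b).
Proof. by rewrite /poly_act mmapC. Qed.

Lemma poly_act_var g i : poly_act g 'X_i = \prod_(j < n) rvar j ^ g j i.
Proof. by rewrite /poly_act mmapX mmap1U. Qed.

(* perm_mx s sends the i-th standard column vector to the (s^-1 i)-th one.    *)
Lemma prod_rvar_permMx g i :
  \prod_(j < n) rvar j ^ g j i = rvar ((perm_of_permMx g)^-1%g i).
Proof.
rewrite (bigD1 ((perm_of_permMx g)^-1%g i)) //= big1 => [|j ne].
  by rewrite permMxE permKV eqxx mulr1 expr1z.
rewrite permMxE; case: eqP => [e|_]; last by rewrite expr0z.
by rewrite -e permK eqxx in ne.
Qed.

Lemma poly_actE g p :
  poly_act g p =
  FracField.tofrac (msym (perm_of_permMx g)^-1%g (map_mpoly (iota g) p)).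
Proof.
rewrite {1 2}[p]mpolyE (raddf_sum (poly_act g)).
rewrite (raddf_sum (map_mpoly (iota g))) (raddf_sum (msym _)) raddf_sum.
apply: eq_bigr => m _.
rewrite -[RHS]/(FracField.tofrac (msym _ (map_mpoly (iota g) _))).
rewrite -[LHS]/(poly_act g _) /poly_act mmapZ mmapX map_mpolyZ map_mpolyX.
rewrite msymZ -mul_mpolyC rmorphM.
congr (_ * _); rewrite /msym mmapX /mmap1 rmorph_prod.
by apply: eq_bigr => i _; rewrite rmorphXn prod_rvar_permMx.
Qed.

Lemma poly_act_eq0 g p : (poly_act g p == 0) = (p == 0).
Proof.
apply/eqP/eqP=> [|->]; last exact: rmorph0.
rewrite poly_actE => /eqP; rewrite tofrac_eq0 => /eqP e0.
have eq0 : map_mpoly (iota g) p = 0.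
  by apply: (inj_msym (perm_of_permMx g)^-1%g); rewrite e0 msym0.
apply/mpolyP=> m; rewrite mcoeff0; apply/eqP; rewrite -(fmorph_eq0 (iota g)).
by rewrite -mcoeff_map_mpoly eq0 mcoeff0.
Qed.

Lemma rat_act_frac g p q : q != 0 ->
  rat_act g (FracField.tofrac p / FracField.tofrac q) =
  poly_act g p / poly_act g q.
Proof.
move=> q0; rewrite /rat_act; set f := (X in repr X).
have d0 := denom_ratioP (repr f).
apply/eqP; rewrite eqr_div ?poly_act_eq0 // -!rmorphM.
apply/eqP; congr (poly_act g _); apply/eqP.
rewrite -tofrac_eq !rmorphM -eqr_div ?tofrac_eq0 //.
by rewrite -fracE.
Qed.

Lemma rat_act_poly g p : rat_act g (FracField.tofrac p) = poly_act g p.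
Proof.
have := rat_act_frac g p (oner_neq0 _).
by rewrite !rmorph1 !divr1.
Qed.

Fact rat_act_is_zmod_morphism g : zmod_morphism (rat_act g).
Proof.
move=> f1 f2; have [d1 d2] := (denom_ratioP (repr f1), denom_ratioP (repr f2)).
rewrite {1}[f1]fracE {1}[f2]fracE -mulNr addf_div ?tofrac_eq0 //.
rewrite -!rmorphN -!rmorphM -rmorphD rat_act_frac ?mulf_neq0 //.
rewrite rmorphD !rmorphM (rmorphN (poly_act g)) -addf_div ?poly_act_eq0 //.
by rewrite mulNr.
Qed.

Fact rat_act_is_monoid_morphism g : monoid_morphism (rat_act g).
Proof.
split=> [|f1 f2].
  by rewrite -[1 in LHS](rmorph1 (@FracField.tofrac {mpoly K[n]}))
             rat_act_poly rmorph1.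
have [d1 d2] := (denom_ratioP (repr f1), denom_ratioP (repr f2)).
rewrite {1}[f1]fracE {1}[f2]fracE mulf_div -!rmorphM rat_act_frac ?mulf_neq0 //.
by rewrite !rmorphM -mulf_div.
Qed.

HB.instance Definition _ g :=
  GRing.isZmodMorphism.Build ratfun ratfun (rat_act g)
    (rat_act_is_zmod_morphism g).
HB.instance Definition _ g :=
  GRing.isMonoidMorphism.Build ratfun ratfun (rat_act g)
    (rat_act_is_monoid_morphism g).

Lemma rat_act_const g b : rat_act g (rconst b) = rconst (iota g b).
Proof. by rewrite rat_act_poly poly_act_const. Qed.

Lemma rat_act_var g i : rat_act g (rvar i) = \prod_(j < n) rvar j ^ g j i.
Proof. by rewrite rat_act_poly poly_act_var. Qed.

Lemma rat_act_mul (G : {group permMx n}) :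
  galois_iso G iota ->
  {in G &, forall g h f, rat_act (g * h)%g f = rat_act g (rat_act h f)}.
Proof.
case=> iotaM _ _ g h Gg Gh f.
have actM p : poly_act (g * h)%g p = rat_act g (poly_act h p).
  rewrite [p]mpolyE (raddf_sum (poly_act _)) (raddf_sum (poly_act h)) raddf_sum.
  apply: eq_bigr => m _.
  rewrite -mul_mpolyC -[LHS]/(poly_act _ _) -[RHS]/(rat_act g (poly_act h _)).
  rewrite !rmorphM /= !poly_act_const rat_act_const -iotaM //.
  congr (_ * _); rewrite mpolyXE_id !rmorph_prod; apply: eq_bigr => i _.
  rewrite !rmorphXn /= !poly_act_var !prod_rvar_permMx rat_act_var.
  by rewrite prod_rvar_permMx perm_of_permMxM invMg permM.
by rewrite [rat_act h f]/rat_act fmorph_div /= -!actM.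
Qed.

End Action.
End Definitions.

(* Subfields are taken as arbitrary Prop-valued sets: quantifying over the    *)
(* boolean predicates of divringClosed only would restrict the intersection   *)
(* below to the decidable subfields.                                          *)
Record is_subfield (L : fieldType) (S : L -> Prop) : Prop := IsSubfield {
  is_subfield1 : S 1;
  is_subfieldB : forall x y, S x -> S y -> S (x - y);
  is_subfieldM : forall x y, S x -> S y -> S (x * y);
  is_subfieldV : forall x, S x -> S x^-1
}.

Definition subfield_gen (L : fieldType) (A : L -> Prop) (x : L) : Prop :=
  forall S : L -> Prop, is_subfield S -> (forall a, A a -> S a) -> S x.

Definition adjoin_base (F : fieldType) (K : splittingFieldType F) (n : nat)
    (y : 'I_n -> ratfun K n) : ratfun K n -> Prop :=
  subfield_gen (fun z => (exists c : F, z = rconst n c%:A) \/ (exists i, z = y i)).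

(* Main.v *)
Require Import Defs.
From mathcomp Require Import all_boot all_order all_algebra all_fingroup all_field.
From mathcomp Require Import generic_quotient fraction.
From mathcomp Require Import mpoly.

Set Implicit Arguments.
Unset Strict Implicit.
Unset Printing Implicit Defensive.

Import GRing.Theory.
Local Open Scope ring_scope.

(** Write Tr f for the sum of g(f) over g in G, on K(x_1, ..., x_n), and E for
    F(y_1, ..., y_n).  That E is fixed by G is a reindexing of the sums y_i.

    For the converse, normality of alpha enters only through the fact that
    Tr(b x_i) belongs to E for all b in K, not just for b = alpha.  Indeed b is
    an F-linear combination of the conjugates h(alpha), and, because G permutes
    the indeterminates, Tr(h(alpha) x_i) = Tr(alpha h^-1(x_i)) is one of the y_j
    ([trace_const_mul_var]).

    The rest is Galois descent ([galois_descent]).  Consider the set S of all f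
    such that Tr(b f) is in E for every b in K.  It contains K, since traces of
    elements of K lie in F, and it contains the x_i.  As the matrix
    (g(w_k))_(g, k) is invertible for suitable elements w_k of K, there are c_k
    in K with f = sum_k c_k Tr(w_k f) for every f ([trace_expansion]); hence
    Tr(b f f') = sum_k Tr(w_k f) Tr(b c_k f'), so that S is a ring.  Moreover S
    is stable under G, and a fixed element f of S is in E, because
    Tr(w_k f) = Tr(w_k) f with Tr(w_k) nonzero for some k.  In particular the
    norm of f in S is in E, which makes S closed under inverses.  Thus S is all
    of K(x_1, ..., x_n), and every fixed element is in E. *)

(** * Subfields as predicates *)

Section SubfieldPredicate.
Variables (L : fieldType) (S : L -> Prop).
Hypothesis subS : is_subfield S.

Lemma is_subfield0 : S 0.
Proof. by rewrite -(subrr 1); apply: is_subfieldB => //; apply: is_subfield1. Qed.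

Lemma is_subfieldD x y : S x -> S y -> S (x + y).
Proof.
move=> Sx Sy; rewrite -[y]opprK -[- y]sub0r.
by do !apply: is_subfieldB => //; apply: is_subfield0.
Qed.

Lemma is_subfield_sum (I : Type) (r : seq I) (P : pred I) (f : I -> L) :
  (forall i, P i -> S (f i)) -> S (\sum_(i <- r | P i) f i).
Proof. exact: (big_ind _ is_subfield0 is_subfieldD). Qed.

Lemma is_subfield_prod (I : Type) (r : seq I) (P : pred I) (f : I -> L) :
  (forall i, P i -> S (f i)) -> S (\prod_(i <- r | P i) f i).
Proof. exact: (big_ind _ (is_subfield1 subS) (is_subfieldM subS)). Qed.

Lemma is_subfieldX x m : S x -> S (x ^+ m).
Proof.
move=> Sx; elim: m => [|m IHm]; rewrite ?expr0 ?exprS.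
  exact: is_subfield1.
exact: is_subfieldM.
Qed.

End SubfieldPredicate.

Lemma subfield_gen_is_subfield (L : fieldType) (A : L -> Prop) :
  is_subfield (subfield_gen A).
Proof.
split=> [|x y genx geny|x y genx geny|x genx] S subS sAS.
- exact: is_subfield1.
- by apply: is_subfieldB => //; [apply: genx | apply: geny].
- by apply: is_subfieldM => //; [apply: genx | apply: geny].
- by apply: is_subfieldV => //; apply: genx.
Qed.

Lemma sub_subfield_gen (L : fieldType) (A : L -> Prop) a :
  A a -> subfield_gen A a.
Proof. by move=> Aa S _; apply. Qed.

Lemma morph_fixed_is_subfield (L : fieldType) (s : {rmorphism L -> L}) :
  is_subfield (fun f => s f = f).
Proof.
split=> [|x y fx fy|x y fx fy|x fx].
- exact: rmorph1.
- by rewrite rmorphB fx fy.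
- by rewrite rmorphM fx fy.
- by rewrite fmorphV fx.
Qed.

(** * Galois descent *)

Section GaloisDescent.
Variables (gT : finGroupType) (G : {group gT}) (L : fieldType).
Variable act : gT -> {rmorphism L -> L}.
Hypothesis actM : {in G &, forall g h f, act (g * h)%g f = act g (act h f)}.

Definition act_trace f := \sum_(g in G) act g f.
Definition act_norm f := \prod_(g in G) act g f.

Lemma act1 f : act 1%g f = f.
Proof. by apply: (fmorph_inj (act 1%g)); rewrite -actM ?mulg1. Qed.

Lemma act_trace_act h f : h \in G -> act_trace (act h f) = act_trace f.
Proof.
move=> Gh; rewrite /act_trace [RHS](reindex_acts 'R _ Gh) ?astabsR //=.
by apply: eq_bigr => g Gg; rewrite actM.
Qed.

Lemma act_act_trace h f : h \in G -> act h (act_trace f) = act_trace f.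
Proof.
move=> Gh; rewrite /act_trace rmorph_sum [RHS](reindex_inj (mulgI h)).
apply: eq_big => [g|g Gg]; first by rewrite groupMl.
by rewrite actM.
Qed.

Lemma act_act_norm h f : h \in G -> act h (act_norm f) = act_norm f.
Proof.
move=> Gh; rewrite /act_norm rmorph_prod [RHS](reindex_inj (mulgI h)).
apply: eq_big => [g|g Gg]; first by rewrite groupMl.
by rewrite actM.
Qed.

Lemma act_traceB f1 f2 : act_trace (f1 - f2) = act_trace f1 - act_trace f2.
Proof. by rewrite -sumrB; apply: eq_bigr => g _; rewrite rmorphB. Qed.

Lemma act_trace_sum (I : finType) (f : I -> L) :
  act_trace (\sum_i f i) = \sum_i act_trace (f i).
Proof.
by rewrite exchange_big; apply: eq_bigr => g _; rewrite rmorph_sum.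
Qed.

Lemma act_trace_mul_fixed e f :
  {in G, forall g, act g f = f} -> act_trace (e * f) = act_trace e * f.
Proof.
by move=> fixf; rewrite mulr_suml; apply: eq_bigr => g Gg; rewrite rmorphM fixf.
Qed.

Section DualFamily.
Variables (I : finType) (c w : I -> L).
Hypothesis dual_cw :
  {in G, forall g, \sum_k c k * act g (w k) = (g == 1%g)%:R}.

(** The family [c] inverts the conjugates of the family [w], so it recovers the
    term [f] of the trace from all the values of the trace pairing. *)
Lemma trace_expansion f : f = \sum_k c k * act_trace (w k * f).
Proof.
under eq_bigr do rewrite mulr_sumr.
rewrite exchange_big (bigD1 1%g) //= [X in _ + X]big1 ?addr0 =>
  [|g /andP[Gg g_neq1]].
  under eq_bigr do rewrite rmorphM mulrA.
  by rewrite -mulr_suml dual_cw // eqxx mul1r act1.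
under eq_bigr do rewrite rmorphM mulrA.
by rewrite -mulr_suml dual_cw // (negPf g_neq1) mul0r.
Qed.

Lemma trace_neq0 : exists k, act_trace (w k) != 0.
Proof.
apply/existsP; apply: contraT; rewrite negb_exists => /forallP tr0.
have/eqP := trace_expansion 1; rewrite big1 ?oner_eq0 // => k _.
by have := tr0 k; rewrite negbK mulr1 => /eqP->; rewrite mulr0.
Qed.

Variables (K E : L -> Prop).
Hypotheses (subK : is_subfield K) (subE : is_subfield E).
Hypothesis K_stable : forall h b, h \in G -> K b -> K (act h b).
Hypothesis K_trace : forall b, K b -> E (act_trace b).
Hypotheses (Kc : forall k, K (c k)) (Kw : forall k, K (w k)).

(** When [G] fixes [E], this is the compositum of [K] and [E].  The description
    by traces avoids choosing decompositions into sums of products. *)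
Definition descends f := forall b, K b -> E (act_trace (b * f)).

Lemma descendsM f1 f2 : descends f1 -> descends f2 -> descends (f1 * f2).
Proof.
move=> D1 D2 b Kb; rewrite [f1]trace_expansion mulr_suml mulr_sumr.
rewrite act_trace_sum; apply: is_subfield_sum => // k _.
have -> : b * (c k * act_trace (w k * f1) * f2)
  = b * c k * f2 * act_trace (w k * f1) by rewrite mulrAC !mulrA.
rewrite act_trace_mul_fixed => [|g Gg]; last exact: act_act_trace.
apply: is_subfieldM => //; last exact/D1.
by apply: D2; apply: is_subfieldM.
Qed.

Lemma descends_const b : K b -> descends b.
Proof. by move=> Kb b' Kb'; apply: K_trace; apply: is_subfieldM. Qed.

Lemma descends_act h f : h \in G -> descends f -> descends (act h f).
Proof.
move=> Gh Df b Kb; rewrite -(act_trace_act _ (groupVr Gh)) rmorphM.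
by rewrite -actM ?groupV // mulVg act1; apply/Df/K_stable; rewrite ?groupV.
Qed.

Lemma descends_fixed f : descends f -> {in G, forall g, act g f = f} -> E f.
Proof.
move=> Df fixf; have [k trk] := trace_neq0.
rewrite -(mulKf trk f) -act_trace_mul_fixed //.
apply: is_subfieldM => //; last exact: Df.
by apply: is_subfieldV => //; apply: K_trace.
Qed.

Lemma descends_prod (J : Type) (r : seq J) (P : pred J) (f : J -> L) :
  (forall j, P j -> descends (f j)) -> descends (\prod_(j <- r | P j) f j).
Proof.
apply: (big_ind descends); last exact: descendsM.
by apply: descends_const; apply: is_subfield1.
Qed.

(** The inverse of [f] is the product of its other conjugates divided by its
    norm, and the norm, being fixed, is already known to be in [E]. *)
Lemma descendsV f : descends f -> descends f^-1.
Proof.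
move=> Df; have [->|f_neq0] := eqVneq f 0.
  rewrite invr0 -(subrr f) => b Kb; rewrite mulrBr act_traceB.
  by apply: is_subfieldB; auto.
have EN : E (act_norm f).
  apply: descends_fixed => [|g Gg]; last exact: act_act_norm.
  by apply: descends_prod => g Gg; apply: descends_act.
have N_eq : act_norm f = f * \prod_(g in G | g != 1%g) act g f.
  by rewrite /act_norm (bigD1 1%g) //= act1.
have N_neq0 : act_norm f != 0.
  by apply/prodf_neq0 => g _; rewrite fmorph_eq0.
have -> : f^-1 = (\prod_(g in G | g != 1%g) act g f) * (act_norm f)^-1.
  by apply: (mulfI f_neq0); rewrite mulrA -N_eq !divff.
move=> b Kb; rewrite mulrA act_trace_mul_fixed => [|g Gg]; last first.
  by rewrite fmorphV act_act_norm.
apply: is_subfieldM => //; last exact: is_subfieldV.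
suff : descends (\prod_(g in G | g != 1%g) act g f) by apply.
by apply: descends_prod => g /andP[Gg _]; apply: descends_act.
Qed.

Lemma descends_is_subfield : is_subfield descends.
Proof.
split; [|move=> f1 f2 D1 D2 b Kb|exact: descendsM|exact: descendsV].
  by apply: descends_const; apply: is_subfield1.
by rewrite mulrBr act_traceB; apply: is_subfieldB; auto.
Qed.

(** The second hypothesis says that the generators in [A] descend to [E].  As the
    elements that descend to [E] form a subfield containing [K], everything
    does, in particular the fixed elements. *)
Theorem galois_descent (A : L -> Prop) :
  (forall f, subfield_gen (fun z => K z \/ A z) f) ->
  (forall b a, K b -> A a -> E (act_trace (b * a))) ->
  forall f, {in G, forall g, act g f = f} -> E f.
Proof.
move=> genL trA f; apply: descends_fixed.
apply: genL descends_is_subfield _ => z [Kz|Az]; first exact: descends_const.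
by move=> b Kb; apply: trA.
Qed.

End DualFamily.
End GaloisDescent.

(** * Dual families of a Galois extension *)

(** By independence of automorphisms, some square matrix of conjugates is
    invertible; [c] is the column of its inverse indexed by the identity. *)
Lemma gal_dual_family {F : fieldType} (K : splittingFieldType F) :
  exists (m : nat) (c w : 'I_m -> K),
    {in 'Gal({:K} / 1)%g, forall s : gal_of {:K},
      \sum_k c k * s (w k) = (s == 1%g)%:R}.
Proof.
set A := 'Gal({:K} / 1)%g.
have [w _ [unitM _ _]] := gal_matrix A.
pose M := \matrix_(i, j < #|A|) (enum_val i : gal_of {:K}) (tnth w j).
pose i1 : 'I_#|A| := enum_rank_in (group1 _) 1%g.
exists #|A|, (fun k => invmx M k i1), (tnth w) => s As.
have := congr1 (fun N : 'M_ _ => N (enum_rank_in (group1 _) s) i1) (mulmxV unitM).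
rewrite !mxE => sumM.
have enumK := enum_rankK_in (group1 _ : 1%g \in A).
transitivity ((enum_rank_in (group1 _ : 1%g \in A) s == i1)%:R : K).
  rewrite -sumM; apply: eq_bigr => k _; by rewrite mulrC mxE enumK.
by rewrite (inj_in_eq (can_in_inj enumK)) ?group1.
Qed.

(** * Rational functions *)

Section RationalFunctions.
Variables (n : nat) (G : {group permMx n}).
Variables (F : fieldType) (K : splittingFieldType F).

Lemma ratfun_generated (f : ratfun K n) :
  subfield_gen (fun z => (exists b, z = rconst n b) \/ exists i, z = rvar K i) f.
Proof.
set gen := subfield_gen _; have subgen : is_subfield gen.
  exact: subfield_gen_is_subfield.
have poly_gen p : gen (FracField.tofrac p : ratfun K n).
  rewrite [p]mpolyE rmorph_sum; apply: is_subfield_sum => // m _.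
  rewrite -mul_mpolyC rmorphM; apply: (is_subfieldM subgen).
    by apply: sub_subfield_gen; left; exists p@_m.
  rewrite mpolyXE_id rmorph_prod; apply: (is_subfield_prod subgen) => i _.
  rewrite rmorphXn; apply: (is_subfieldX subgen).
  by apply: sub_subfield_gen; right; exists i.
rewrite [f]fracE; apply: (is_subfieldM subgen); first exact: poly_gen.
by apply: (is_subfieldV subgen); apply: poly_gen.
Qed.

Lemma rconst_is_subfield :
  is_subfield (fun z : ratfun K n => exists b, z = rconst n b).
Proof.
split=> [|_ _ [b1 ->] [b2 ->]|_ _ [b1 ->] [b2 ->]|_ [b ->]].
- by exists 1; rewrite rmorph1.
- by exists (b1 - b2); rewrite rmorphB.
- by exists (b1 * b2); rewrite rmorphM.
- by exists b^-1; rewrite fmorphV.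
Qed.

Hypothesis galKF : galois 1%AS {:K}.
Variable iota : permMx n -> gal_of {:K}.
Hypothesis iota_iso : galois_iso G iota.

Let act g : {rmorphism ratfun K n -> ratfun K n} := rat_act iota g.

Lemma iota_gal g : g \in G -> iota g \in 'Gal({:K} / 1)%g.
Proof. by case: iota_iso => _ _ <- Gg; apply: imset_f. Qed.

Lemma rat_act_base g (a : F) : act g (rconst n a%:A) = rconst n a%:A.
Proof. by rewrite /= rat_act_const linearZ /= rmorph1. Qed.

Lemma trace_rconst b : exists a : F, act_trace G act (rconst n b) = rconst n a%:A.
Proof.
have [_ iota_inj iotaG] := iota_iso.
have [|a tr_b] := vlineP _ _ (_ : galTrace 1 {:K} b \in 1%VS).
  by apply: mem_galTrace => //; apply: memvf.
exists a; rewrite -tr_b /galTrace -iotaG big_imset //= rmorph_sum.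
by apply: eq_bigr => g _; apply: rat_act_const.
Qed.

(** The isomorphism transports dual families, because it sends the neutral
    element, and no other one, to the neutral element. *)
Lemma rconst_dual_family : exists (m : nat) (c w : 'I_m -> K),
  {in G, forall g, \sum_k rconst n (c k) * act g (rconst n (w k))
                   = (g == 1%g)%:R}.
Proof.
have [iotaM iota_inj _] := iota_iso.
have [m [c [w dual_cw]]] := gal_dual_family K.
exists m, c, w => g Gg.
transitivity (rconst n (\sum_k c k * iota g (w k))).
  rewrite rmorph_sum; apply: eq_bigr => k _.
  by rewrite rmorphM /= rat_act_const.
rewrite dual_cw ?iota_gal // rmorph_nat; congr (nat_of_bool _)%:R.
have iota1 : iota 1%g = 1%g.
  apply/eqP/gal_eqP => a _; rewrite gal_id.
  by apply: (fmorph_inj (iota 1%g));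
     have /= <- := iotaM _ _ (group1 G) (group1 G) a; rewrite mulg1.
by rewrite -iota1 (inj_in_eq iota_inj).
Qed.

(** Expand [b] in the normal basis and move the automorphism [h] of a conjugate
    of [alpha] over to the indeterminate, which [h^-1] merely permutes. *)
Lemma trace_const_mul_var alpha b i : normal_element alpha ->
  adjoin_base (fun j => act_trace G act (rconst n alpha * rvar K j))
    (act_trace G act (rconst n b * rvar K i)).
Proof.
have actM := rat_act_mul iota_iso; have [_ iota_inj iotaG] := iota_iso.
move=> /andP[/eqP spanK _]; set y := fun j => _.
have subE := subfield_gen_is_subfield _ : is_subfield (adjoin_base y).
have : b \in {:K}%VS by apply: memvf.
rewrite -spanK span_def big_image /= -iotaG big_imset //=.
case/memv_sumP=> v v_line ->.
rewrite rmorph_sum mulr_suml /act_trace.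
under eq_bigr do rewrite rmorph_sum.
rewrite exchange_big; apply: (is_subfield_sum subE) => h Gh.
have /vlineP[a ->] := v_line h Gh.
rewrite -/(act_trace G act _) -mulr_algl rmorphM -mulrA mulrC.
rewrite act_trace_mul_fixed; last first.
  by move=> g _; apply: rat_act_base.
apply: (is_subfieldM subE); last by apply: sub_subfield_gen; left; exists a.
apply: sub_subfield_gen; right.
(* The index of the indeterminate h^-1(x_i). *)
exists ((perm_of_permMx h^-1)^-1 i)%g; rewrite /y.
rewrite -[RHS](act_trace_act actM _ Gh) /act rmorphM /= rat_act_const.
congr (act_trace _ _ (_ * _)).
rewrite -prod_rvar_permMx -(rat_act_var iota) -actM ?groupV // mulgV.
by rewrite (act1 actM).
Qed.

End RationalFunctions.

Theorem theorem2 (n : nat) (n_gt0 : (0 < n)%N) (G : {group permMx n})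
    (F : fieldType) (K : splittingFieldType F) (galKF : galois 1%AS {:K})
    (iota : permMx n -> gal_of {:K}) (iota_iso : galois_iso G iota)
    (alpha : K) (alpha_normal : normal_element alpha) :
  let y (i : 'I_n) : ratfun K n :=
    \sum_(g in G) rat_act iota g (rconst n alpha * rvar K i) in
  forall f : ratfun K n, fixed_by iota G f <-> adjoin_base y f.
Proof.
move=> y f; pose act g : {rmorphism ratfun K n -> ratfun K n} := rat_act iota g.
have actM : {in G &, forall g h f, act (g * h)%g f = act g (act h f)}.
  exact: rat_act_mul.
split=> [fix_f|Ef g Gg].
  have [m [c [w dual_cw]]] := rconst_dual_family iota_iso.
  have subE : is_subfield (adjoin_base y) := subfield_gen_is_subfield _.
  apply: (galois_descent actM dual_cw (rconst_is_subfield n K) subE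
            _ _ _ _ (@ratfun_generated n F K)) fix_f.
  - by move=> g _ Gg [b ->]; exists (iota g b); apply: rat_act_const.
  - move=> _ [b ->]; have [a tr_b] := trace_rconst galKF iota_iso b.
    by rewrite tr_b; apply: sub_subfield_gen; left; exists a.
  - by move=> k; exists (c k).
  - by move=> k; exists (w k).
  - by move=> _ _ [b ->] [i ->]; apply: trace_const_mul_var.
apply: (Ef _ (morph_fixed_is_subfield (act g))) => _ [[a ->]|[i ->]].
  exact: rat_act_base.
exact: act_act_trace.
Qed.
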